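(* Let $\Psi(s)$ be a $p\times p$-valued rational $\mathcal{GPE}$ function which is not analytic on $i\mathbb{R}$. Assume that $\lim_{s\to\infty}\Psi(s)=0$ and let $\Psi(s)=C(sI_{2n}-A)^{-1}B$ be a state space realization of the form $$A=\begin{pmatrix}\hat A&\hat B\hat B^*\\ 0&-\hat A^*\end{pmatrix},\quad B=\begin{pmatrix}0\\ -\hat C^*\end{pmatrix},\quad C=\begin{pmatrix}\hat C&0\end{pmatrix},$$ with $\hat A\in\mathbb{C}^{n\times n}$ and $\hat B,\hat C^*\in\mathbb{C}^{n\times p}$. There exists a static output feedback gain $K\in\mathbb{C}^{p\times p}$ with $-K\in\overline{\mathbb P}_p$ such that the closed loop system $(I_p-\Psi K)^{-1}\Psi$ is analytic on $i\mathbb{R}$ if and only if for all $r\in\mathbb{R}$ the two matrices $$\begin{pmatrix}\hat A-irI_n&\hat B\end{pmatrix}\in\mathbb{C}^{n\times(n+p)}\quad\text{and}\quad\begin{pmatrix}\hat A-irI_n\\ \hat C\end{pmatrix}\in\mathbb{C}^{(n+p)\times n}$$ are of full rank.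
   Context: $\overline{\mathbb P}_p$ is the set of $p\times p$ (Hermitian) positive semidefinite matrices. A $p\times p$-valued complex rational function $\Psi$ is even generalized positive, $\Psi\in\mathcal{GPE}$, if $\Psi(i\omega)\in\overline{\mathbb P}_p$ for almost every $\omega\in\mathbb{R}$. $X^*$ denotes the conjugate transpose of $X$. Static output feedback: for a system $y(s)=\Psi(s)u(s)$ one sets $u=Ky+u'$ with $K$ a constant matrix and $u'$ an auxiliary input, giving the closed loop $y=(I_p-\Psi K)^{-1}\Psi u'$.
   Formalization: Closed loop analytic on iR here also requires the resolvent (sI-(A+BKC))^{-1} to be analytic on iR (no hidden imaginary modes); with only (I-ΨK)^{-1}Ψ analytic the ''only if'' fails, e.g. Â=diag(0,i), B̂=(1,0)^T, Ĉ=(1,0), K=-1. *)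

(* Defs.v *)
From HB Require Import structures.
From mathcomp Require Import all_boot all_order all_algebra.
From mathcomp Require Export complex.
From mathcomp Require Import all_classical all_reals all_analysis.

Set Implicit Arguments.
Unset Strict Implicit.
Unset Printing Implicit Defensive.

Import Order.TTheory GRing.Theory Num.Theory.

Local Open Scope classical_set_scope.
Local Open Scope sesquilinear_scope.
Local Open Scope complex_scope.
Local Open Scope ring_scope.

Notation ratfun R := {fraction {poly R[i]}}.

Definition ratC (R : realType) (c : R[i]) : ratfun R :=
  FracField.tofrac (c%:P).

Definition rats (R : realType) : ratfun R := FracField.tofrac 'X.

(* The relation is functional in v.  Cancelling common factors of a / b is
   allowed, so removable singularities are removed. *)
Definition has_value (R : realType) (f : ratfun R) (z v : R[i]) : Prop :=
  exists a b : {poly R[i]},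
    [/\ b.[z] != 0, f = FracField.tofrac a / FracField.tofrac b
      & v = a.[z] / b.[z]].

(* For a rational function, being analytic at z means not having a pole there. *)
Definition analytic_at (R : realType) (f : ratfun R) (z : R[i]) : Prop :=
  exists v, has_value f z v.

Definition mx_has_value (R : realType) (p q : nat) (F : 'M[ratfun R]_(p, q))
    (z : R[i]) (V : 'M[R[i]]_(p, q)) : Prop :=
  forall i j, has_value (F i j) z (V i j).

Definition iR (R : realType) (r : R) : R[i] := 0 +i* r.

Definition analytic_on_iR (R : realType) (p q : nat)
    (F : 'M[ratfun R]_(p, q)) : Prop :=
  forall (r : R) i j, analytic_at (F i j) (iR r).

(* On R[i], 0 <= z means that z is real and nonnegative. *)
Definition psd (R : realType) (p : nat) (M : 'M[R[i]]_p) : Prop :=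
  M ^t* = M /\ forall v : 'cV[R[i]]_p, 0 <= (v ^t* *m M *m v) 0 0.

Definition GPE (R : realType) (p : nat) (Psi : 'M[ratfun R]_p) : Prop :=
  {ae lebesgue_measure, forall w : R,
    exists2 V, mx_has_value Psi (iR w) V & psd V}.

Definition vanishes_at_infinity (R : realType) (p q : nat)
    (F : 'M[ratfun R]_(p, q)) : Prop :=
  forall e : R, 0 < e -> exists M : R, forall s : R[i], M%:C < `|s| ->
    forall i j, exists2 v, has_value (F i j) s v & `|v| < e%:C.

Definition transfer (R : realType) (m p q : nat) (A : 'M[R[i]]_m)
    (B : 'M[R[i]]_(m, q)) (C : 'M[R[i]]_(p, m)) : 'M[ratfun R]_(p, q) :=
  map_mx (@ratC R) C *m invmx ((rats R)%:M - map_mx (@ratC R) A)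
    *m map_mx (@ratC R) B.

Definition closed_loop (R : realType) (p : nat) (Psi : 'M[ratfun R]_p)
    (K : 'M[R[i]]_p) : 'M[ratfun R]_p :=
  invmx (1%:M - Psi *m map_mx (@ratC R) K) *m Psi.

(* Substituting u = K y + u' in x' = A x + B u, y = C x gives the closed loop
   system x' = (A + B K C) x + B u', y = C x, whose transfer function is
   (1 - Psi K)^-1 Psi when Psi(s) = C (s - A)^-1 B.  The realization need not be
   minimal, and the closed loop is a system rather than only its transfer
   function: besides the transfer function, the resolvent
   (s - (A + B K C))^-1 is required to be analytic on iR, that is, no mode of
   the closed loop on iR may be hidden by a cancellation.  The transfer function
   alone would not do: for Psi >= 0 on iR, the function
   (1 + Psi)^-1 Psi = 1 - (1 + Psi)^-1 is bounded on iR, hence analytic there,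
   whatever the realization. *)
Definition closed_loop_analytic_on_iR (R : realType) (m p : nat)
    (Psi : 'M[ratfun R]_p) (A : 'M[R[i]]_m) (B : 'M[R[i]]_(m, p))
    (C : 'M[R[i]]_(p, m)) (K : 'M[R[i]]_p) : Prop :=
  [/\ 1%:M - Psi *m map_mx (@ratC R) K \in unitmx,
      analytic_on_iR (closed_loop Psi K)
    & analytic_on_iR
        (invmx ((rats R)%:M - map_mx (@ratC R) (A + B *m K *m C)))].

(* Main.v *)
Require Import Defs.
From mathcomp Require Import all_boot all_order all_algebra.
From mathcomp Require Import all_classical all_reals all_analysis.

Set Implicit Arguments.
Unset Strict Implicit.
Unset Printing Implicit Defensive.

Import Order.TTheory GRing.Theory Num.Theory.

Local Open Scope sesquilinear_scope.
Local Open Scope complex_scope.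
Local Open Scope ring_scope.

(** Feeding [u = K y + u'] back into the realization [(A, B, C)] replaces [A] by
    [A + B K C] and changes nothing else.  The transfer function of the closed
    loop is therefore [C (s - (A + B K C))^-1 B] ([closed_loop_resolvent],
    [feedback_wellposed]), so both it and the resolvent are analytic on the
    imaginary axis as soon as [A + B K C] has no eigenvalue there; conversely a
    resolvent [(s - M)^-1] that is analytic at [z] takes there a value inverse
    to [z - M] ([resolvent_analytic_unit]).  The question is thus when
    some [K <= 0] removes all the eigenvalues of [A + B K C] from the axis.

    Put [L = - K >= 0] and [Z = Ah - i r].  Since [(i r)^* = - i r], the matrix
    [A + B K C - i r] is
    [[
         Z            Bh Bh^*
         Ch^* L Ch    - Z^*
    ]]
    If [x] is a nonzero vector with [Z x = 0] and [Ch x = 0], then [(x, 0)] is in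
    the kernel whatever [L] is, and a nonzero [y] with [Z^* y = 0] and
    [Bh^* y = 0] gives [(0, y)] likewise: the two rank conditions are necessary.
    They are sufficient because [L = 1] already works.  Indeed, if [(x, y)] is in
    the kernel, then computing [y^* Z x] from each of the two block rows gives
    [- |Bh^* y|^2 = y^* Z x = |Ch x|^2], so that both sides vanish; then
    [Z x = 0] and [Z^* y = 0], and the rank conditions force
    [x = 0] and [y = 0]. *)

(** * Kernels and Hermitian squares *)

Lemma mxrank_full_cV (F : fieldType) (m n : nat) (A : 'M[F]_(m, n)) :
  \rank A = n <-> (forall v : 'cV_n, A *m v = 0 -> v = 0).
Proof.
rewrite -mxrank_tr; split=> [/eqP rA v Av0|kerA].
  apply: trmx_inj; apply: (row_free_inj rA).
  by rewrite -trmx_mul Av0 !trmx0 mul0mx.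
apply/eqP; rewrite -[_ == _]/(row_free A^T) -kermx_eq0.
apply/rowV0P => u /sub_kermxP uA0.
apply: trmx_inj; rewrite trmx0; apply: kerA.
by apply: trmx_inj; rewrite trmx_mul trmxK uA0 trmx0.
Qed.

Lemma unitmx_cV (F : fieldType) (n : nat) (A : 'M[F]_n) :
  A \in unitmx <-> (forall v : 'cV_n, A *m v = 0 -> v = 0).
Proof. by rewrite -mxrank_full_cV -row_full_unit; split=> /eqP. Qed.

Lemma adjmx_mul (C : numClosedFieldType) (m n p : nat)
    (M : 'M[C]_(m, n)) (N : 'M[C]_(n, p)) :
  (M *m N) ^t* = N ^t* *m M ^t*.
Proof. by rewrite trmx_mul map_mxM. Qed.

Lemma mxrank_adj (C : numClosedFieldType) (m n : nat) (M : 'M[C]_(m, n)) :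
  \rank (M ^t*) = \rank M.
Proof. by rewrite mxrank_map mxrank_tr. Qed.

Lemma hermitian_square_ge0 (C : numClosedFieldType) (n : nat) (v : 'cV[C]_n) :
  0 <= (v ^t* *m v) 0 0.
Proof.
by rewrite mxE sumr_ge0 // => i _; rewrite !mxE mulrC mul_conjC_ge0.
Qed.

Lemma hermitian_square_eq0 (C : numClosedFieldType) (n : nat) (v : 'cV[C]_n) :
  (v ^t* *m v) 0 0 = 0 -> v = 0.
Proof.
rewrite mxE => /eqP; rewrite psumr_eq0; last first.
  by move=> i _; rewrite !mxE mulrC mul_conjC_ge0.
move=> /allP v0; apply/colP => i; rewrite mxE; apply/eqP.
by have := v0 i (mem_index_enum i); rewrite !mxE mulrC mul_conjC_eq0.
Qed.

Lemma psd1 (R : realType) (p : nat) : psd (1%:M : 'M[R[i]]_p).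
Proof.
split=> [|v]; first by rewrite trmx1 map_mx1.
by rewrite mulmx1 hermitian_square_ge0.
Qed.

(** * The kernel of a Hamiltonian block matrix *)

(** For [Z = Ah - z] with [z] on the imaginary axis and [L = - K], this is
    [A + B K C - z]; it is Hamiltonian when [L] is Hermitian. *)
Definition hamiltonian (C : numClosedFieldType) (n p : nat) (Z : 'M[C]_n)
    (B : 'M[C]_(n, p)) (D : 'M[C]_(p, n)) (L : 'M[C]_p) : 'M[C]_(n + n) :=
  block_mx Z (B *m B ^t*) (D ^t* *m L *m D) (- Z ^t*).

Lemma hamiltonian_ker_observable (C : numClosedFieldType) (n p : nat)
    (Z : 'M[C]_n) (B : 'M[C]_(n, p)) (D : 'M[C]_(p, n)) (L : 'M[C]_p)
    (x : 'cV[C]_n) :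
  Z *m x = 0 -> D *m x = 0 ->
  hamiltonian Z B D L *m col_mx x 0 = 0.
Proof.
move=> Zx Dx; rewrite mul_block_col Zx -!mulmxA Dx !mulmx0 !addr0.
exact: col_mx0.
Qed.

Lemma hamiltonian_ker_controllable (C : numClosedFieldType) (n p : nat)
    (Z : 'M[C]_n) (B : 'M[C]_(n, p)) (D : 'M[C]_(p, n)) (L : 'M[C]_p)
    (y : 'cV[C]_n) :
  Z ^t* *m y = 0 -> B ^t* *m y = 0 ->
  hamiltonian Z B D L *m col_mx 0 y = 0.
Proof.
move=> Zy By; rewrite mul_block_col -!mulmxA mulNmx Zy By oppr0.
by rewrite !mulmx0 !addr0; apply: col_mx0.
Qed.

(** The number [y^* Z x] equals [- |B^* y|^2] by the first block row and
    [|D x|^2] by the second, and two nonnegative numbers of sum zero vanish. *)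
Lemma hamiltonian1_ker (C : numClosedFieldType) (n p : nat)
    (Z : 'M[C]_n) (B : 'M[C]_(n, p)) (D : 'M[C]_(p, n)) (x y : 'cV[C]_n) :
  hamiltonian Z B D 1%:M *m col_mx x y = 0 ->
  [/\ Z *m x = 0, D *m x = 0, Z ^t* *m y = 0 & B ^t* *m y = 0].
Proof.
rewrite mul_block_col mulmx1 -col_mx0 => /eq_col_mx[/eqP eq1 /eqP eq2].
move: eq1; rewrite addr_eq0 -mulmxA => /eqP Zx.
move: eq2; rewrite mulNmx subr_eq0 -mulmxA => /eqP Zy.
have yZx1 : y ^t* *m (Z *m x) = - ((B ^t* *m y) ^t* *m (B ^t* *m y)).
  by rewrite Zx mulmxN adjmx_mul trmxCK !mulmxA.
have yZx2 : y ^t* *m (Z *m x) = (D *m x) ^t* *m (D *m x).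
  rewrite mulmxA -[Z in LHS]trmxCK -adjmx_mul -Zy !adjmx_mul trmxCK.
  by rewrite !mulmxA.
have /eqP : ((D *m x) ^t* *m (D *m x)) 0 0
          + ((B ^t* *m y) ^t* *m (B ^t* *m y)) 0 0 = 0.
  by rewrite -yZx2 yZx1 mxE addNr.
rewrite paddr_eq0 ?hermitian_square_ge0 // => /andP[/eqP Dx0 /eqP By0].
move/hermitian_square_eq0: Dx0 => Dx0; move/hermitian_square_eq0: By0 => By0.
by rewrite Zx -Zy Dx0 By0 !mulmx0 oppr0.
Qed.

(** * Output feedback acts on the resolvent *)

Section Feedback.
Variables (F : fieldType) (m p q : nat) (M N : 'M[F]_m) (B : 'M[F]_(m, q))
  (C : 'M[F]_(p, m)) (K : 'M[F]_(q, p)).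
Hypotheses (uM : M \in unitmx) (uN : N \in unitmx) (NE : N = M - B *m K *m C).

(** This is [M^-1 = M^-1 N N^-1 = N^-1 - M^-1 (B K C) N^-1], multiplied by [C]. *)
Lemma return_difference_resolvent :
  (1%:M - C *m invmx M *m B *m K) *m (C *m invmx N) = C *m invmx M.
Proof.
have resolventE : invmx M = invmx N - invmx M *m (B *m K *m C) *m invmx N.
  rewrite -[in LHS](mulmxK uN (invmx M)) NE mulmxBr mulVmx // mulmxBl mul1mx.
  by rewrite -NE.
by rewrite [in RHS]resolventE mulmxBr mulmxBl mul1mx !mulmxA.
Qed.

Lemma feedback_wellposed : 1%:M - C *m invmx M *m B *m K \in unitmx.
Proof.
suff /mulmx1_unit[] : (1%:M - C *m invmx M *m B *m K)
                      *m (1%:M + C *m invmx N *m B *m K) = 1%:M by [].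
rewrite mulmxDr mulmx1 !mulmxA -[_ *m C *m invmx N]mulmxA.
by rewrite return_difference_resolvent subrK.
Qed.

Lemma closed_loop_resolvent :
  invmx (1%:M - C *m invmx M *m B *m K) *m (C *m invmx M *m B)
  = C *m invmx N *m B.
Proof.
apply: (canLR (mulKmx feedback_wellposed)).
by rewrite [RHS]mulmxA return_difference_resolvent.
Qed.

End Feedback.

(** * Values of rational functions at a point *)

Section Values.
Variables (R : realType) (z : R[i]).
Local Notation "p %:F" := (FracField.tofrac p).
Implicit Types (f g : ratfun R) (v w : R[i]).

Let nonroot_neq0 (b : {poly R[i]}) : b.[z] != 0 -> b != 0.
Proof. by apply: contraNneq => ->; rewrite horner0. Qed.

Lemma has_value_tofrac (a : {poly R[i]}) : has_value a%:F z a.[z].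
Proof.
by exists a, 1; rewrite hornerC oner_neq0 tofrac1 !divr1.
Qed.

Lemma has_valueD f g v w :
  has_value f z v -> has_value g z w -> has_value (f + g) z (v + w).
Proof.
move=> [a [b [b0 -> ->]]] [c [d [d0 -> ->]]].
exists (a * d + c * b), (b * d).
split; first by rewrite hornerM mulf_neq0.
  by rewrite tofracD !tofracM addf_div // tofrac_eq0 nonroot_neq0.
by rewrite hornerD !hornerM addf_div.
Qed.

Lemma has_valueM f g v w :
  has_value f z v -> has_value g z w -> has_value (f * g) z (v * w).
Proof.
move=> [a [b [b0 -> ->]]] [c [d [d0 -> ->]]].
exists (a * c), (b * d).
split; first by rewrite hornerM mulf_neq0.
  by rewrite !tofracM mulf_div.
by rewrite !hornerM mulf_div.
Qed.

Lemma has_value_unique f v w : has_value f z v -> has_value f z w -> v = w.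
Proof.
move=> [a [b [b0 -> ->]]] [c [d [d0 /eqP]]].
rewrite eqr_div ?tofrac_eq0 ?nonroot_neq0 // -!tofracM tofrac_eq => /eqP adE.
by move=> ->; apply/eqP; rewrite eqr_div // -!hornerM adE.
Qed.

Lemma mx_has_value_mul (m n p : nat) (F : 'M[ratfun R]_(m, n))
    (G : 'M[ratfun R]_(n, p)) (V : 'M[R[i]]_(m, n)) (W : 'M[R[i]]_(n, p)) :
  mx_has_value F z V -> mx_has_value G z W -> mx_has_value (F *m G) z (V *m W).
Proof.
move=> FV GW i j; rewrite !mxE.
elim/big_ind2: _ => [|f1 v1 f2 v2|k _]; last exact: has_valueM.
  by have := has_value_tofrac 0; rewrite tofrac0 horner0.
exact: has_valueD.
Qed.

Lemma mx_has_value_tofrac (m n : nat) (P : 'M[{poly R[i]}]_(m, n)) :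
  mx_has_value (map_mx (@FracField.tofrac _) P) z
    (map_mx (fun a => a.[z]) P).
Proof. by move=> i j; rewrite !mxE; apply: has_value_tofrac. Qed.

Lemma mx_has_value_unique (m n : nat) (F : 'M[ratfun R]_(m, n))
    (V W : 'M[R[i]]_(m, n)) :
  mx_has_value F z V -> mx_has_value F z W -> V = W.
Proof. by move=> FV FW; apply/matrixP => i j; apply: has_value_unique (FW i j). Qed.

Lemma mx_has_valueP (m n : nat) (F : 'M[ratfun R]_(m, n)) :
  (forall i j, analytic_at (F i j) z) <-> exists V, mx_has_value F z V.
Proof.
split=> [anF|[V FV] i j]; last by exists (V i j); apply: FV.
have /choice[V FV] : forall ij : 'I_m * 'I_n,
  exists v, has_value (F ij.1 ij.2) z v by move=> ij; apply: anF.
by exists (\matrix_(i, j) V (i, j)) => i j; rewrite mxE; apply: FV (i, j).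
Qed.

End Values.

(** * The resolvent of a constant matrix *)

Section Resolvent.
Variables (R : realType) (m : nat).
Implicit Types (A : 'M[R[i]]_m) (z : R[i]).
Local Notation tofrac := (@FracField.tofrac {poly R[i]}).

Lemma map_ratCE (k l : nat) (M : 'M[R[i]]_(k, l)) :
  map_mx (@ratC R) M = map_mx tofrac (map_mx polyC M).
Proof. by rewrite -map_mx_comp. Qed.

Lemma map_ratC_mul (k l n : nat) (M : 'M[R[i]]_(k, l)) (N : 'M[R[i]]_(l, n)) :
  map_mx (@ratC R) (M *m N) = map_mx (@ratC R) M *m map_mx (@ratC R) N.
Proof. by rewrite !map_ratCE !map_mxM. Qed.

Lemma mx_has_value_ratC z (k l : nat) (M : 'M[R[i]]_(k, l)) :
  mx_has_value (map_mx (@ratC R) M) z M.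
Proof.
rewrite map_ratCE; have := mx_has_value_tofrac z (map_mx polyC M).
by congr mx_has_value; apply/matrixP => i j; rewrite !mxE hornerC.
Qed.

Lemma sI_subE A :
  (rats R)%:M - map_mx (@ratC R) A = map_mx tofrac (char_poly_mx A).
Proof. by rewrite map_ratCE /char_poly_mx map_mxB map_scalar_mx. Qed.

Lemma horner_char_poly_mx A z :
  map_mx (fun a => a.[z]) (char_poly_mx A) = z%:M - A.
Proof.
by apply/matrixP => i j; rewrite !mxE hornerD hornerN hornerC hornerMn hornerX.
Qed.

Lemma sI_sub_unit A : (rats R)%:M - map_mx (@ratC R) A \in unitmx.
Proof.
rewrite sI_subE unitmxE det_map_mx unitfE tofrac_eq0.
exact/monic_neq0/char_poly_monic.
Qed.

(** By Cramer's rule, the determinant of [z - A] is the only denominator. *)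
Lemma resolvent_analytic_unit A z :
  (forall i j, analytic_at (invmx ((rats R)%:M - map_mx (@ratC R) A) i j) z)
  <-> z%:M - A \in unitmx.
Proof.
have valM := mx_has_value_tofrac z (char_poly_mx A).
rewrite horner_char_poly_mx in valM.
split=> [/mx_has_valueP[V valV]|uA i j].
  have [|//] := @mulmx1_unit _ _ (z%:M - A) V.
  apply: mx_has_value_unique (mx_has_value_mul valM valV) _.
  rewrite -sI_subE mulmxV ?sI_sub_unit //.
  have := mx_has_value_ratC z (1%:M : 'M[R[i]]_m).
  by rewrite map_ratCE !map_mx1.
exists ((\adj (char_poly_mx A) i j).[z] / (char_poly A).[z]).
exists (\adj (char_poly_mx A) i j), (char_poly A); split=> //.
  rewrite -[_.[z]]/(horner_eval z _) -det_map_mx.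
  have -> : map_mx (horner_eval z) (char_poly_mx A) = z%:M - A.
    exact: horner_char_poly_mx.
  by rewrite -unitfE -unitmxE.
rewrite /invmx sI_sub_unit sI_subE det_map_mx -map_mx_adj !mxE.
exact: mulrC.
Qed.

End Resolvent.

(** The transfer function of the closed loop is [C (s - (A + B K C))^-1 B] with
    [B] and [C] constant, so it is analytic wherever the resolvent is. *)
Lemma closed_loop_analytic_on_iRP (R : realType) (m p : nat)
    (A : 'M[R[i]]_m) (B : 'M[R[i]]_(m, p)) (C : 'M[R[i]]_(p, m))
    (K : 'M[R[i]]_p) :
  closed_loop_analytic_on_iR (transfer A B C) A B C K <->
  (forall r : R, A + B *m K *m C - (iR r)%:M \in unitmx).
Proof.
have uN (r : R) : (A + B *m K *m C - (iR r)%:M \in unitmx)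
                = ((iR r)%:M - (A + B *m K *m C) \in unitmx).
  by rewrite -opprB -scaleN1r unitmxZ ?unitrN1.
split=> [[_ _ anN] r|unitN].
  by rewrite uN; apply/resolvent_analytic_unit/anN.
have anN : analytic_on_iR
    (invmx ((rats R)%:M - map_mx (@ratC R) (A + B *m K *m C))).
  by move=> r; apply/resolvent_analytic_unit; rewrite -uN.
have NE : (rats R)%:M - map_mx (@ratC R) (A + B *m K *m C)
  = (rats R)%:M - map_mx (@ratC R) A
    - map_mx (@ratC R) B *m map_mx (@ratC R) K *m map_mx (@ratC R) C.
  rewrite -!map_ratC_mul -addrA -opprD; congr (_ - _).
  by rewrite !map_ratCE !map_mxD.
have uM := sI_sub_unit A; have uN' := sI_sub_unit (A + B *m K *m C).
split; [exact: feedback_wellposed uM uN' NE| |exact: anN].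
move=> r; apply/mx_has_valueP.
rewrite /closed_loop (closed_loop_resolvent uM uN' NE).
have /mx_has_valueP[V valV] := anN r.
exists (C *m V *m B).
by do !apply: mx_has_value_mul => //; apply: mx_has_value_ratC.
Qed.

Lemma feedback_hamiltonian (R : realType) (n p : nat) (Ah : 'M[R[i]]_n)
    (Bh : 'M[R[i]]_(n, p)) (Ch : 'M[R[i]]_(p, n)) (K : 'M[R[i]]_p) (r : R) :
  block_mx Ah (Bh *m Bh ^t*) 0 (- Ah ^t*)
    + col_mx 0 (- Ch ^t*) *m K *m row_mx Ch 0 - (iR r)%:M
  = hamiltonian (Ah - (iR r)%:M) Bh Ch (- K).
Proof.
have conj_iR : (iR r)^* = - iR r by apply/eqP; rewrite eq_complex /= oppr0 !eqxx.
have adjZ : (Ah - (iR r)%:M) ^t* = Ah ^t* + (iR r)%:M.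
  rewrite linearB /= tr_scalar_mx map_mxB map_scalar_mx /= conj_iR.
  by rewrite raddfN opprK.
rewrite mul_col_mx mul_col_row !mul0mx mulmx0 add_block_mx !addr0 add0r.
rewrite scalar_mx_block opp_block_mx add_block_mx !oppr0 !addr0 /hamiltonian.
by rewrite adjZ opprD !mulNmx mulmxN mulNmx.
Qed.

Theorem proposition1p2 (R : realType) (n p : nat) (Psi : 'M[ratfun R]_p)
    (Ah : 'M[R[i]]_n) (Bh : 'M[R[i]]_(n, p)) (Ch : 'M[R[i]]_(p, n))
    (A : 'M[R[i]]_(n + n)) (B : 'M[R[i]]_(n + n, p)) (C : 'M[R[i]]_(p, n + n)) :
  GPE Psi ->
  ~ analytic_on_iR Psi ->
  vanishes_at_infinity Psi ->
  A = block_mx Ah (Bh *m Bh ^t*) 0 (- Ah ^t*) ->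
  B = col_mx 0 (- Ch ^t*) ->
  C = row_mx Ch 0 ->
  Psi = transfer A B C ->
  (exists K : 'M[R[i]]_p,
     psd (- K) /\ closed_loop_analytic_on_iR Psi A B C K)
  <->
  (forall r : R,
     \rank (row_mx (Ah - (iR r)%:M) Bh) = n /\
     \rank (col_mx (Ah - (iR r)%:M) Ch) = n).
Proof.
move=> _ _ _ -> -> -> ->; split=> [[K [_ /closed_loop_analytic_on_iRP clK]] r|full].
  have /unitmx_cV := clK r; rewrite feedback_hamiltonian => ker0; split.
    rewrite -mxrank_adj; apply/mxrank_full_cV => y.
    rewrite tr_row_mx map_col_mx mul_col_mx -col_mx0 => /eq_col_mx[Zy By].
    have := ker0 _ (hamiltonian_ker_controllable _ _ Zy By).
    by rewrite -col_mx0 => /eq_col_mx[].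
  apply/mxrank_full_cV => x; rewrite mul_col_mx -col_mx0 => /eq_col_mx[Zx Cx].
  have := ker0 _ (hamiltonian_ker_observable _ _ Zx Cx).
  by rewrite -col_mx0 => /eq_col_mx[].
exists (- 1%:M); split; first by rewrite opprK; apply: psd1.
apply/closed_loop_analytic_on_iRP => r; rewrite feedback_hamiltonian opprK.
have [rB rC] := full r; apply/unitmx_cV => v; rewrite -[v]vsubmxK.
move=> /hamiltonian1_ker[Zx Cx Zy By].
have -> : usubmx v = 0.
  by apply: (mxrank_full_cV _).1 rC _ _; rewrite mul_col_mx Zx Cx col_mx0.
suff -> : dsubmx v = 0 by rewrite col_mx0.
move: rB; rewrite -mxrank_adj => /mxrank_full_cV; apply.
by rewrite tr_row_mx map_col_mx mul_col_mx Zy By col_mx0.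
Qed.
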